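(* There exist an absolute constant $C>0$ and infinitely many positive integers $n$ for which there is an order-$n$ Latin square $L$ with $\varepsilon(L)\le C n^2$ (and hence, since every Latin square has $\varepsilon(L)=\Omega(n^2)$, $\varepsilon(L)=\Theta(n^2)$).
   Context: Write $[n]=\{1,\dots,n\}$. An order-$n$ Latin square is a map $L:[n]\times[n]\to[n]$ such that for each fixed $i$ the map $j\mapsto L(i,j)$ is a bijection and for each fixed $j$ the map $i\mapsto L(i,j)$ is a bijection. For $X,Y,Z\subseteq[n]$, the box $X\times Y\times Z$ is called an empty box of $L$ if there are no $i\in X$, $j\in Y$ with $L(i,j)\in Z$; its volume is $|X||Y||Z|$. $\varepsilon(L)$ denotes the maximum volume of an empty box of $L$. *)

(* Defs.v *)
From mathcomp Require Import all_boot all_order all_algebra.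
From mathcomp Require Import classical_sets cardinality reals.

Set Implicit Arguments.
Unset Strict Implicit.
Unset Printing Implicit Defensive.

(* [n] = {1, ..., n} is represented by 'I_n = {0, ..., n - 1}. *)
Definition latin_square (n : nat) (L : 'I_n -> 'I_n -> 'I_n) : Prop :=
  (forall i, bijective (fun j => L i j)) /\
  (forall j, bijective (fun i => L i j)).

Definition empty_box (n : nat) (L : 'I_n -> 'I_n -> 'I_n)
    (X Y Z : {set 'I_n}) : bool :=
  ~~ [exists i in X, exists j in Y, L i j \in Z].

Definition box_volume (n : nat) (X Y Z : {set 'I_n}) : nat :=
  #|X| * #|Y| * #|Z|.

(* B = ((X, Y), Z). The range is never vacuous: the box with X = set0 is
   always empty, so this is a genuine maximum. *)
Definition eps (n : nat) (L : 'I_n -> 'I_n -> 'I_n) : nat :=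
  \max_(B : {set 'I_n} * {set 'I_n} * {set 'I_n}
         | empty_box L B.1.1 B.1.2 B.2) box_volume B.1.1 B.1.2 B.2.

(* Main.v *)
(* Let G be an elementary abelian 2-group of order n.  In the Cayley table of G,
   the rows i, i + a and columns j, j + a carry an intercalate (a 2 x 2 Latin
   subsquare) on the symbols i + j, i + j + a; switching it puts the symbol
   i + j + a in cell (i, j), so every triple (i, j, k) off the Cayley table is
   created by switching exactly one intercalate; a triple on the Cayley table is
   kept by freezing its cell, a degenerate intercalate with a = 0.  Disjoint intercalates can be
   switched independently, so it suffices to find pairwise disjoint ones that
   create a triple in every box of volume more than 1024 n^2.

   Such a family exists by a potential argument.  Weigh each box B not yet hit by
   (1 + x)^(number of incidences between the triples of B and the occupied
   cells), with x of order 1/n, and take a family of disjoint intercalates of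
   least total weight.  This weight is at most the number 8^n of boxes, so in an
   unhit B at most half of the candidates are blocked.  Averaging over all
   available intercalates, the chance that the next one hits B outweighs the mean
   growth of the weight of B, so if some box were unhit the weight could be
   lowered.

   Conversely, one row X, half of the columns Y, and the symbols Z missing from
   X * Y span an empty box of volume about n^2 / 4. *)

Require Import Defs.
From mathcomp Require Import all_boot all_order all_algebra.
From mathcomp Require Import classical_sets cardinality reals.
From mathcomp Require Import fintype finset.
From mathcomp Require Import lra zify.

Set Implicit Arguments.
Unset Strict Implicit.
Unset Printing Implicit Defensive.
Import Order.TTheory GRing.Theory Num.Theory.
Local Open Scope ring_scope.

(** * Linear bounds on powers of 1 + x *)

Lemma exprD1_le (R : realFieldType) (x : R) (m : nat) :
  0 <= x -> x * m%:R <= 2^-1 -> (1 + x) ^+ m <= 1 + 2 * (x * m%:R).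
Proof.
move=> x0; elim: m => [|m IHm] xm; first by rewrite expr0 mulr0; lra.
have mm : 0 <= x * m%:R by rewrite mulr_ge0.
move: xm; rewrite -natr1 mulrDr mulr1 => xm.
have {}IHm := IHm ltac:(lra).
rewrite exprS; apply: le_trans (ler_wpM2l _ IHm) _; first lra.
have : x * (x * m%:R) <= x * 2^-1 by apply: ler_wpM2l; lra.
lra.
Qed.

Lemma exprD1_ge (R : realFieldType) (x : R) (m : nat) :
  0 <= x -> 1 + x * m%:R <= (1 + x) ^+ m.
Proof.
move=> x0; elim: m => [|m IHm]; first by rewrite expr0 mulr0; lra.
have mm : 0 <= x * m%:R by rewrite mulr_ge0.
rewrite -natr1 mulrDr mulr1 exprS.
apply: le_trans (ler_wpM2l _ IHm); last lra.
have := mulr_ge0 x0 mm; lra.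
Qed.

Lemma disjointsU1 (T : finType) (t : T) (M B : {set T}) :
  [disjoint t |: M & B] = (t \notin B) && [disjoint M & B].
Proof. by rewrite -!setI_eq0 setIUl setU_eq0 !setI_eq0 disjoints1. Qed.

(** * Matchings that hit all large sets *)

Section HittingMatching.

Variables (T S : finType) (Q : T -> {set S}) (r D : nat).
Hypotheses (r_gt0 : (0 < r)%N) (D_gt0 : (0 < D)%N).
Hypothesis card_Q : forall t, (#|Q t| <= r)%N.
Hypothesis deg_Q : forall c, (#|[set t | c \in Q t]| <= D)%N.

Definition cover_of (M : {set T}) : {set S} := \bigcup_(t in M) Q t.

Definition degree_in (B : {set T}) (c : S) : nat := #|[set t in B | c \in Q t]|.

Definition load (B : {set T}) (O : {set S}) : nat := \sum_(c in O) degree_in B c.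

Definition is_matching (M : {set T}) : bool :=
  [forall t in M, forall u in M, (t != u) ==> [disjoint Q t & Q u]].

Lemma sum_degree_in (B : {set T}) (f : S -> nat) :
  (\sum_c f c * degree_in B c = \sum_(t in B) \sum_(c in Q t) f c)%N.
Proof.
rewrite (exchange_big_dep xpredT) //=; apply: eq_bigr => c _.
rewrite /degree_in -sum1_card big_distrr /=; apply: eq_big => [t|t _].
  by rewrite inE.
by rewrite muln1.
Qed.

Lemma degree_in_le (B : {set T}) (c : S) : (degree_in B c <= D)%N.
Proof.
apply: leq_trans (deg_Q c); apply: subset_leq_card.
by apply/subsetP => t; rewrite !inE => /andP[].
Qed.

Lemma load_Q_le (B : {set T}) (t : T) : (load B (Q t) <= r * D)%N.
Proof.
apply: leq_trans (_ : \sum_(c in Q t) D <= _)%N.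
  by apply: leq_sum => c _; exact: degree_in_le.
by rewrite sum_nat_const leq_mul2r card_Q orbT.
Qed.

(** Swapping sums gives the sum over [c] of the degree of [c] in [B] times its degree in [T]. The
    latter is at most [D], and the former add up to at most [r * #|B|]. *)
Lemma sum_load_Q_le (B : {set T}) : (\sum_t load B (Q t) <= r * D * #|B|)%N.
Proof.
have -> : (\sum_t load B (Q t) = \sum_c degree_in B c * degree_in [set: T] c)%N.
  by rewrite sum_degree_in; apply: eq_bigl => t; rewrite inE.
apply: leq_trans (_ : \sum_c D * degree_in B c <= _)%N.
  by apply: leq_sum => c _; rewrite mulnC leq_mul2r degree_in_le orbT.
rewrite sum_degree_in.
apply: leq_trans (_ : \sum_(t in B) r * D <= _)%N.
  by apply: leq_sum => t _; rewrite sum_nat_const leq_mul2r card_Q orbT.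
by rewrite sum_nat_const mulnC.
Qed.

Lemma loadU_le (B : {set T}) (O1 O2 : {set S}) :
  (load B (O1 :|: O2) <= load B O1 + load B O2)%N.
Proof.
rewrite /load (big_setID O1) /= setUK leq_add2l setDUl setDv set0U.
rewrite [leqRHS](big_setID O1) /=; exact: leq_addl.
Qed.

Lemma blocked_le (B : {set T}) (O : {set S}) :
  (#|[set t in B | ~~ [disjoint Q t & O]]| <= load B O)%N.
Proof.
have -> : load B O = (\sum_c (c \in O) * degree_in B c)%N.
  rewrite /load big_mkcond; apply: eq_bigr => c _.
  by case: (c \in O); rewrite ?mul1n ?mul0n.
rewrite sum_degree_in -sum1_card.
under eq_bigl do rewrite inE.
rewrite big_mkcondr; apply: leq_sum => t _.
case: ifPn => // /pred0Pn[c /= /andP[ct cO]].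
by rewrite (bigD1 c) //= cO.
Qed.

(** Scaled so that one new [t], of load at most [r * D], keeps [x] times its load at most 1/8, in
    the range of [exprD1_le], while every [8 * r * D] units of load at least double the weight. *)
Let x : rat := (8 * r * D)%:R^-1.

Let x_ge0 : 0 <= x. Proof. by rewrite invr_ge0. Qed.

Let xrD : x * (r * D)%:R = 8%:R^-1.
Proof.
by rewrite /x -mulnA natrM invfM mulfVK // pnatr_eq0 -lt0n muln_gt0 r_gt0.
Qed.

Definition weight (B M : {set T}) : rat := (1 + x) ^+ load B (cover_of M).

Lemma weight_gt0 (B M : {set T}) : 0 < weight B M.
Proof. by rewrite exprn_gt0 // ltr_wpDr. Qed.

Lemma weightU1_le (B M : {set T}) (t : T) :
  weight B (t |: M) <= weight B M * (1 + 2 * (x * (load B (Q t))%:R)).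
Proof.
rewrite /weight; have -> : cover_of (t |: M) = cover_of M :|: Q t.
  by rewrite /cover_of bigcup_setU big_set1 setUC.
apply: (@le_trans _ _ ((1 + x) ^+ (load B (cover_of M) + load B (Q t)))).
  by apply: ler_weXn2l (loadU_le _ _ _); rewrite lerDl.
rewrite exprD ler_wpM2l ?(ltW (weight_gt0 _ _)) // exprD1_le //.
apply: (@le_trans _ _ (x * (r * D)%:R)); last by rewrite xrD; lra.
by rewrite ler_wpM2l // ler_nat load_Q_le.
Qed.

Lemma weight_ge (N : nat) (B M : {set T}) :
  (8 * r * D * N <= load B (cover_of M))%N -> (2 ^ N)%:R <= weight B M.
Proof.
move=> le_load; apply: (@le_trans _ _ ((1 + x) ^+ (8 * r * D * N))).
  rewrite exprM natrX lerXn2r ?nnegrE ?exprn_ge0 ?addr_ge0 //.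
  apply: le_trans (exprD1_ge _ x_ge0).
  rewrite mulVf ?pnatr_eq0 -?lt0n ?muln_gt0 ?r_gt0 //; lra.
by apply: ler_weXn2l le_load; rewrite lerDl.
Qed.

Definition available (M : {set T}) : {set T} :=
  [set t | [disjoint Q t & cover_of M]].

Lemma is_matchingU1 (M : {set T}) (t : T) :
  is_matching M -> t \in available M -> is_matching (t |: M).
Proof.
rewrite inE => matchM tM.
have disj u : u \in M -> [disjoint Q t & Q u].
  by move=> uM; apply: disjointWr tM; exact: bigcup_sup.
apply/'forall_implyP => u; rewrite !inE => uM.
apply/'forall_implyP => v; rewrite !inE => vM; apply/implyP => uv.
case/predU1P: uM vM uv => [-> | uM] /predU1P[-> | vM] uv.
- by rewrite eqxx in uv.
- exact: disj.
- by rewrite disjoint_sym disj.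
- move/'forall_implyP: matchM => /(_ _ uM) /'forall_implyP /(_ _ vM).
  by move/implyP; apply.
Qed.

(* Averaged over the available t, extending M by t lowers the total weight of
   the sets not yet met: among them only B loses weight by being met, with
   probability above (#|B| / 2) / #|available M|, and this beats the mean growth
   (#|B| / 4) / #|available M| of the weight. *)
Lemma sum_weightU1_lt (N : nat) (B M : {set T}) :
  (0 < N)%N -> (16 * r * D * N <= #|B|)%N -> weight B M < (2 ^ N)%:R ->
  \sum_(t in available M :\: B) weight B (t |: M)
    < weight B M * #|available M|%:R.
Proof.
move=> N_gt0 leB wlt; set A := available M; set w := weight B M in wlt *.
have w_gt0 : 0 < w by exact: weight_gt0.
have load_lt : (load B (cover_of M) < 8 * r * D * N)%N.
  by rewrite ltnNge; apply/negP => /weight_ge; rewrite leNgt wlt.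
have B_gt0 : (0 < #|B|)%N by apply: leq_trans leB; rewrite !muln_gt0 r_gt0 D_gt0.
have capB : (#|B| <= #|A :&: B| + load B (cover_of M))%N.
  rewrite -(cardsID A B) setIC leq_add2l; apply: leq_trans (blocked_le _ _).
  apply: subset_leq_card; apply/subsetP => t; rewrite !inE.
  by rewrite andbC.
apply: (@le_lt_trans _ _
    (w * \sum_(t in A :\: B) (1 + 2 * (x * (load B (Q t))%:R)))).
  rewrite mulr_sumr; apply: ler_sum => t _; exact: weightU1_le.
rewrite ltr_pM2l // big_split /= sumr_const -!mulr_sumr -natr_sum.
have sumQ : x * (\sum_(t in A :\: B) load B (Q t))%:R <= 8%:R^-1 * #|B|%:R.
  rewrite -xrD -mulrA ler_wpM2l // -natrM ler_nat.
  apply: leq_trans (sum_load_Q_le B).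
  by rewrite [leqRHS](bigID [in A :\: B]) leq_addr.
(* The load is below [8 * r * D * N], hence below half of [#|B|], and bounds the number of blocked
   members of [B]. *)
have halfB : (#|B| < 2 * #|A :&: B|)%N by lia.
have -> : (#|A| = #|A :&: B| + #|A :\: B|)%N by rewrite cardsID.
have : #|B|%:R < 2 * #|A :&: B|%:R :> rat by rewrite -natrM ltr_nat.
have : 0 < #|B|%:R :> rat by rewrite ltr0n.
by rewrite natrD; lra.
Qed.

Definition potential (F : {set {set T}}) (M : {set T}) : rat :=
  \sum_(B in F | [disjoint M & B]) weight B M.

Lemma potential_decreases (N : nat) (F : {set {set T}}) (M B0 : {set T}) :
  (0 < N)%N -> (forall B, B \in F -> (16 * r * D * N <= #|B|)%N) ->
  potential F M < (2 ^ N)%:R -> B0 \in F -> [disjoint M & B0] ->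
  exists2 t, t \in available M & potential F (t |: M) < potential F M.
Proof.
move=> N_gt0 leF pot_lt B0F B0M; set A := available M.
have [/exists_inP[t tA lt_t] | noA] :=
  boolP [exists t in A, potential F (t |: M) < potential F M]; first by exists t.
have weight_lt B : B \in F -> [disjoint M & B] -> weight B M < (2 ^ N)%:R.
  move=> BF BM; apply: le_lt_trans pot_lt.
  rewrite /potential (bigD1 B) ?BF //= lerDl sumr_ge0 // => B' _.
  exact: ltW (weight_gt0 _ _).
have : \sum_(t in A) potential F M <= \sum_(t in A) potential F (t |: M).
  apply: ler_sum => t tA; rewrite leNgt; apply: contra noA => lt_t.
  by apply/exists_inP; exists t.
rewrite sumr_const -mulr_natr leNgt => /negP[].
have -> : \sum_(t in A) potential F (t |: M) =
    \sum_(B in F | [disjoint M & B]) \sum_(t in A :\: B) weight B (t |: M).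
  rewrite /potential (exchange_big_dep (fun B => (B \in F) && [disjoint M & B])) /=.
    apply: eq_bigr => B /andP[BF BM]; apply: eq_bigl => t.
    by rewrite BF /= disjointsU1 BM andbT !inE andbC.
  by move=> t B _; rewrite disjointsU1 => /and3P[-> _ ->].
rewrite /potential mulr_suml.
(* A strict inequality of sums needs a nonempty index set; [B0] provides it. *)
apply: ltr_sum.
  by apply/hasP; exists B0; rewrite ?mem_index_enum // B0F.
move=> B /andP[BF BM]; apply: (@sum_weightU1_lt N) => //; first exact: leF.
exact: weight_lt.
Qed.

(** Take a matching of least potential. It is at most the potential [#|F|] of [set0], so a missed
    [B] would allow an extension of lower potential. *)
Lemma hitting_matching (N : nat) (F : {set {set T}}) :
  (#|F| < 2 ^ N)%N -> (forall B, B \in F -> (16 * r * D * N <= #|B|)%N) ->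
  exists2 M, is_matching M & forall B, B \in F -> ~~ [disjoint M & B].
Proof.
move=> cardF leF.
have match0 : is_matching set0.
  by apply/'forall_implyP => u; rewrite inE.
have pot0 : potential F set0 < (2 ^ N)%:R.
  apply: le_lt_trans (_ : #|F|%:R < _); last by rewrite ltr_nat.
  rewrite -sumr_const /potential big_mkcondr; apply: ler_sum => B _.
  case: ifP => // _; rewrite /weight /cover_of big_set0 /load big_set0 expr0 //.
case: (@arg_minP _ _ _ set0 is_matching (potential F) match0) => M matchM minM.
exists M => // B BF; apply/negP => BM.
have N_gt0 : (0 < N)%N.
  case: N cardF {leF pot0} => //; rewrite expn0 ltnS leqn0 cards_eq0 => /eqP F0.
  by rewrite F0 inE in BF.
have [t tA] := potential_decreases N_gt0 leF (le_lt_trans (minM _ match0) pot0) BF BM.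
by rewrite ltNge minM // is_matchingU1.
Qed.

End HittingMatching.

(** * Switching intercalates in an elementary abelian 2-group *)

Section Intercalates.

Variable G : finZmodType.
Hypothesis addGG : forall u : G, u + u = 0.

Let addGK (u a : G) : u + a + a = u. Proof. by rewrite -addrA addGG addr0. Qed.

Let eqGD (u v a : G) : (u == v + a) = (v == u + a).
Proof. by apply/eqP/eqP => ->; rewrite addGK. Qed.

Definition intercalate (t : G * G * G) : {set G * G} :=
  setX [set t.1.1; t.1.1 + t.2] [set t.1.2; t.1.2 + t.2].

Lemma card_intercalate (t : G * G * G) : (#|intercalate t| <= 4)%N.
Proof.
by rewrite cardsX !cards2; apply: (@leq_mul _ _ 2 2); case: (_ != _).
Qed.

Lemma intercalate_sym (c d : G * G) (a : G) :
  (c \in intercalate (d, a)) = (d \in intercalate (c, a)).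
Proof.
by rewrite !inE /= (eqGD c.1) (eqGD c.2) (eq_sym c.1) (eq_sym c.2).
Qed.

Lemma card_intercalates_at (c : G * G) :
  (#|[set t | c \in intercalate t]| <= 4 * #|G|)%N.
Proof.
(* The booleans say whether the base row and column are shifted from those of [c]. For shift 0 the
   choices coincide, so [f] is only shown to be onto. *)
pose f (p : bool * bool * G) : G * G * G :=
  (c.1 + (if p.1.1 then p.2 else 0), c.2 + (if p.1.2 then p.2 else 0), p.2).
have -> : (4 * #|G| = #|[set: bool * bool * G]|)%N.
  by rewrite cardsT !card_prod card_bool.
apply: leq_trans (leq_imset_card f _); apply/subset_leq_card/subsetP.
case=> d a; rewrite inE intercalate_sym !inE /= => /andP[d1 d2].
apply/imsetP; exists (d.1 != c.1, d.2 != c.2, a); rewrite ?inE // /f /=.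
congr (_, _); case: d d1 d2 => i j /= d1 d2; congr (_, _).
  by case: eqVneq d1 => [-> | _ /eqP->]; rewrite ?addr0.
by case: eqVneq d2 => [-> | _ /eqP->]; rewrite ?addr0.
Qed.

(* Switching the intercalates of a matching M in the Cayley table u + v adds
   [switch M c] to the entry in cell c; the sum has at most one term. *)
Definition switch (M : {set G * G * G}) (c : G * G) : G :=
  \sum_(t in M | c \in intercalate t) t.2.

Lemma switch_in (M : {set G * G * G}) (t : G * G * G) (c : G * G) :
  is_matching intercalate M -> t \in M -> c \in intercalate t ->
  switch M c = t.2.
Proof.
move=> /'forall_implyP matchM tM ct.
have /'forall_implyP matcht := matchM _ tM.
rewrite /switch (big_pred1 t) // => u /=; apply/andP/eqP => [[uM cu] | -> //].
apply/eqP; apply: contraTT cu => ut.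
by rewrite (disjointFr (implyP (matcht _ uM) _)) // eq_sym.
Qed.

Lemma switch_out (M : {set G * G * G}) (c : G * G) :
  ~~ [exists t in M, c \in intercalate t] -> switch M c = 0.
Proof.
move=> noM; rewrite /switch big_pred0 // => t.
by apply/negP => /andP[tM ct]; case/exists_inP: noM; exists t.
Qed.

(** Cells (u, v) and (u, v + a) lie in the same intercalates of shift a; an uncovered cell has
    switch 0. *)
Lemma switch_row (M : {set G * G * G}) (u v : G) :
  is_matching intercalate M -> switch M (u, v + switch M (u, v)) = switch M (u, v).
Proof.
move=> matchM.
have [/exists_inP[t tM] | /switch_out sw0] :=
  boolP [exists t in M, (u, v) \in intercalate t]; last by rewrite sw0 addr0.
move=> ct; rewrite (switch_in matchM tM ct); apply: switch_in => //.
by move: ct; rewrite !inE /= => /andP[-> /orP[]/eqP->]; rewrite ?addGK ?eqxx ?orbT.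
Qed.

Lemma switch_col (M : {set G * G * G}) (u v : G) :
  is_matching intercalate M -> switch M (u + switch M (u, v), v) = switch M (u, v).
Proof.
move=> matchM.
have [/exists_inP[t tM] | /switch_out sw0] :=
  boolP [exists t in M, (u, v) \in intercalate t]; last by rewrite sw0 addr0.
move=> ct; rewrite (switch_in matchM tM ct); apply: switch_in => //.
by move: ct; rewrite !inE /= => /andP[/orP[]/eqP-> ->]; rewrite ?addGK ?eqxx ?orbT.
Qed.

Definition table (M : {set G * G * G}) (u v : G) : G := u + v + switch M (u, v).

(** By [switch_row], v -> v + [switch M (u, v)] is an involution, and the row is its translate by
    u. *)
Lemma table_row_inj (M : {set G * G * G}) (u : G) :
  is_matching intercalate M -> injective (table M u).
Proof.
move=> matchM v1 v2; rewrite /table -!addrA => /addrI eqv.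
have := switch_row u v1 matchM; rewrite eqv switch_row // => eqs.
by apply: (@addIr _ (switch M (u, v1))); rewrite eqv eqs.
Qed.

Lemma table_col_inj (M : {set G * G * G}) (v : G) :
  is_matching intercalate M -> injective (table M ^~ v).
Proof.
move=> matchM u1 u2; rewrite /table ![_ + v]addrC -!addrA => /addrI equ.
have := switch_col u1 v matchM; rewrite equ switch_col // => eqs.
by apply: (@addIr _ (switch M (u1, v))); rewrite equ eqs.
Qed.

(* For a = 0 the intercalate is the single cell (i, j), and having it in the
   matching keeps the entry i + j there. *)
Definition box_hitters (X Y Z : {set G}) : {set G * G * G} :=
  [set t | [&& t.1.1 \in X, t.1.2 \in Y & t.1.1 + t.1.2 + t.2 \in Z]].

Lemma card_box_hitters (X Y Z : {set G}) :
  (#|X| * #|Y| * #|Z| <= #|box_hitters X Y Z|)%N.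
Proof.
(* As u + u = 0, the shift that creates k in cell (i, j) is i + j + k. *)
pose f (p : G * G * G) := (p.1, p.1.1 + p.1.2 + p.2).
have f_inj : injective f.
  by move=> [c k] [d l] [->] /addrI ->.
rewrite -!cardsX -(card_imset (mem (setX (setX X Y) Z)) f_inj).
apply: subset_leq_card.
apply/subsetP => _ /imsetP[[[i j] k] /[!inE] /andP[/andP[/= iX jY] kZ] ->].
by rewrite /f /= iX jY [_ + (_ + k)]addrA addGG add0r kZ.
Qed.

(** With r = 4 and D = N = [4 * #|G|], the threshold [16 * r * D * N] is [1024 * #|G| ^ 2], and the
    at most [8 ^ #|G|] boxes are fewer than [2 ^ N]. *)
Lemma exists_table :
  exists2 M, is_matching intercalate M & forall X Y Z : {set G},
    (1024 * #|G| ^ 2 < #|X| * #|Y| * #|Z|)%N ->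
    [exists i in X, exists j in Y, table M i j \in Z].
Proof.
have n_gt0 : (0 < #|G|)%N by apply/card_gt0P; exists 0.
pose big (B : {set G} * {set G} * {set G}) :=
  (1024 * #|G| ^ 2 < #|B.1.1| * #|B.1.2| * #|B.2|)%N.
pose F := [set box_hitters B.1.1 B.1.2 B.2 | B in [set B | big B]].
have cardF : (#|F| < 2 ^ (4 * #|G|))%N.
  apply: leq_ltn_trans (leq_imset_card _ _) _.
  apply: leq_ltn_trans (max_card _) _.
  rewrite !card_prod -!cardsT -!powersetT !card_powerset cardsT -!expnD.
  by rewrite ltn_exp2l //; move: #|G| n_gt0 => n; lia.
have [|||M matchM hitM] := @hitting_matching _ _ intercalate 4 (4 * #|G|) _ _
  card_intercalate card_intercalates_at (4 * #|G|) F cardF.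
- by [].
- by rewrite muln_gt0.
- move=> _ /imsetP[[[X Y] Z] + ->]; rewrite inE /big /= => bigB.
  apply: leq_trans (ltnW (leq_trans bigB (card_box_hitters X Y Z))).
  by move: #|G| => n; lia.
exists M => // X Y Z bigB.
have /hitM : box_hitters X Y Z \in F by apply/imsetP; exists (X, Y, Z); rewrite ?inE.
case/pred0Pn=> -[[i j] a] /= /andP[tM]; rewrite inE /= => /and3P[iX jY ijZ].
apply/exists_inP; exists i => //; apply/exists_inP; exists j => //.
by rewrite /table (switch_in matchM tM) // !inE /= !eqxx.
Qed.

Lemma exists_latin_square :
  exists2 L : 'I_#|G| -> 'I_#|G| -> 'I_#|G|,
    latin_square L & (eps L <= 1024 * #|G| ^ 2)%N.
Proof.
have [M matchM hitM] := exists_table.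
exists (fun i j => enum_rank (table M (enum_val i) (enum_val j))).
  split=> i; apply: injF_bij => j k /enum_rank_inj.
    by move/(table_row_inj matchM)/enum_val_inj.
  by move/(table_col_inj matchM)/enum_val_inj.
apply/bigmax_leqP => -[[X Y] Z] /=; rewrite leqNgt; apply: contra => bigB.
have inj_val := @enum_val_inj G predT.
have := hitM (enum_val @: X) (enum_val @: Y) (enum_val @: Z).
rewrite !card_imset // => /(_ bigB) /exists_inP[_ /imsetP[i iX ->]].
move=> /exists_inP[_ /imsetP[j jY ->]] /imsetP[k kZ eqk].
apply/exists_inP; exists i => //; apply/exists_inP; exists j => //.
by rewrite eqk enum_valK.
Qed.

End Intercalates.

(** * The quadratic lower bound *)

Lemma eps_ge (n : nat) (L : 'I_n -> 'I_n -> 'I_n) :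
  (1 < n)%N -> (n ^ 2 <= 8 * eps L)%N.
Proof.
case: n L => // n L n_gt0.
have le_half : (n.+1./2 <= n.+1)%N by lia.
pose Y := [set widen_ord le_half j | j : 'I_(n.+1./2)].
pose Z := ~: [set L ord0 j | j in Y].
have cardY : #|Y| = n.+1./2.
  by rewrite card_imset ?card_ord // => i j [] /val_inj.
have cardZ : (n.+1 - n.+1./2 <= #|Z|)%N.
  rewrite cardsCs /Z setCK card_ord; apply: leq_sub2l.
  exact: leq_trans (leq_imset_card _ _) (eq_leq cardY).
have emptyB : empty_box L [set ord0] Y Z.
  apply/exists_inP => -[_ /set1P-> /exists_inP[j jY]].
  by rewrite inE imset_f.
have : (#|[set ord0 : 'I_n.+1]| * #|Y| * #|Z| <= eps L)%N.
  exact: (@leq_bigmax_cond _ _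
    (fun B => box_volume B.1.1 B.1.2 B.2) ([set ord0], Y, Z) emptyB).
rewrite cards1 mul1n cardY; move: cardZ n_gt0; set z := #|Z|; set e := eps L.
move=> zn n_gt0 ze.
have : (n.+1./2 * (n.+1 - n.+1./2) <= e)%N.
  by apply: leq_trans ze; rewrite leq_mul2l zn orbT.
(* For order m, the product of the two halves is at least (m^2 - 1)/4, which is at least m^2/8 once
   m >= 2. *)
nia.
Qed.

(** * Infinitely many orders *)

Theorem theorem1p3 (R : realType) :
  exists C c : R,
    [/\ 0 < C, 0 < c,
        (exists n0 : nat, forall (n : nat) (L : 'I_n -> 'I_n -> 'I_n),
           (n0 <= n)%N -> latin_square L -> c * n%:R ^+ 2 <= (eps L)%:R)
      & infinite_set
          [set n : nat | (0 < n)%N /\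
             exists L : 'I_n -> 'I_n -> 'I_n,
               [/\ latin_square L,
                   (eps L)%:R <= C * n%:R ^+ 2
                 & c * n%:R ^+ 2 <= (eps L)%:R]]%classic].
Proof.
have lower (n : nat) (L : 'I_n -> 'I_n -> 'I_n) :
    (1 < n)%N -> 8%:R^-1 * n%:R ^+ 2 <= (eps L)%:R :> R.
  move=> /(eps_ge L) leL.
  by rewrite mulrC ler_pdivrMr // mulrC -natrX -natrM ler_nat.
exists 1024%:R, 8%:R^-1; split; rewrite ?invr_gt0 ?ltr0n //.
  by exists 2 => n L n2 _; exact: lower.
set A := (X in infinite_set X) => finA.
apply: infinite_nat.
(* The injection d -> [2 ^ d.+1] would pull a finite set of orders back to all of [nat]. The
   exponent starts at 1 because [lower] asks for order at least 2. *)
have -> : [set: nat]%classic = ((fun d => 2 ^ d.+1)%N @^-1` A)%classic.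
  apply/seteqP; split=> // d _; rewrite /A /=; split; first by rewrite expn_gt0.
  pose G : finZmodType := 'rV['F_2]_d.+1.
  have cardG : #|G| = (2 ^ d.+1)%N by rewrite card_mx card_Fp // mul1n.
  have addGG (u : G) : u + u = 0.
    by rewrite -mulr2n -scaler_nat pchar_Zp // scale0r.
  rewrite -cardG.
  have [L latinL leL] := exists_latin_square addGG.
  exists L; split=> //; first by rewrite -natrX -natrM ler_nat.
  by apply: lower; rewrite cardG expnS; have := expn_gt0 2 d; lia.
apply: finite_preimage finA => d e _ _ /eqP.
by rewrite eqn_exp2l // => /eqP[].
Qed.
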